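(* Let $\mathcal{T}$ be a triangulated category with a bounded $t$-structure. Let $G$ be an object of $\mathcal{T}$ and $d$ a positive integer. Let $\mathcal{P}$ be a collection of objects of $\mathcal{T}$ such that for each object $E$ of $\mathcal{T}$ and each integer $a$, there is a map $P \to E$ with $P \in \mathcal{P}$ which is an isomorphism in degrees $\geq a$. Then the following are equivalent: (1) $\mathcal{T} = \langle G \rangle_d$; (2) $\mathcal{P} \subseteq \langle G \rangle_d$.
   Context: For a $t$-structure $(\mathcal{T}^{\leq 0},\mathcal{T}^{\geq 0})$ on $\mathcal{T}$ (cohomological indexing), $\mathcal{T}^{\leq n}=\mathcal{T}^{\leq 0}[-n]$, $\mathcal{T}^{\geq n}=\mathcal{T}^{\geq 0}[-n]$, $\tau_{\leq n},\tau_{\geq n}$ are the truncation functors, and $H^n(E)=\tau_{\leq 0}\tau_{\geq 0}(E[n])$ is the $n$-th cohomology functor to the heart. The $t$-structure is bounded if every object lies in $\mathcal{T}^{\leq n}\cap\mathcal{T}^{\geq -n}$ for some integer $n>0$. A morphism $f$ is an isomorphism in degrees $\geq a$ if $H^n(f)$ is an isomorphism for all $n\geq a$. For a subcategory $\mathcal{S}$ of $\mathcal{T}$, $\operatorname{add}(\mathcal{S})$ is the smallest strictly full subcategory of $\mathcal{T}$ containing $\mathcal{S}$ closed under shifts, finite coproducts and retracts; $\langle \mathcal{S}\rangle_0$ consists of the objects isomorphic to zero, $\langle \mathcal{S}\rangle_1=\operatorname{add}(\mathcal{S})$, and for $n \geq 2$, $\langle \mathcal{S}\rangle_n=\operatorname{add}(\{\operatorname{cone}(\varphi):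 \varphi\in\operatorname{Hom}_{\mathcal{T}}(A,B),\ A\in\langle\mathcal{S}\rangle_{n-1},\ B\in\langle\mathcal{S}\rangle_1\})$. For an object $G$, $\langle G\rangle_n=\langle\{G\}\rangle_n$. *)

(* Defs.v *)
From HB Require Import structures.
From mathcomp Require Import all_boot all_order all_algebra.
From mathcomp Require Import boolp.

Set Implicit Arguments.
Unset Strict Implicit.
Unset Printing Implicit Defensive.

Import Order.TTheory GRing.Theory Num.Theory.
Local Open Scope ring_scope.

(* Full subcategories, and collections of objects, are predicates on objects. *)

(* The Hom-groups are zmodTypes; classically the eqType/choiceType structure  *)
(* this carries is no restriction on the abelian groups allowed.              *)
Record preaddCat := PreaddCat {
  Ob :> Type;
  mor : Ob -> Ob -> zmodType;
  idm : forall X, mor X X;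
  mcomp : forall X Y Z, mor Y Z -> mor X Y -> mor X Z;
  comp1m : forall X Y (f : mor X Y), mcomp (idm Y) f = f;
  compm1 : forall X Y (f : mor X Y), mcomp f (idm X) = f;
  compA : forall X Y Z W (h : mor Z W) (g : mor Y Z) (f : mor X Y),
    mcomp h (mcomp g f) = mcomp (mcomp h g) f;
  compDl : forall X Y Z (g g' : mor Y Z) (f : mor X Y),
    mcomp (g + g') f = mcomp g f + mcomp g' f;
  compDr : forall X Y Z (g : mor Y Z) (f f' : mor X Y),
    mcomp g (f + f') = mcomp g f + mcomp g f'
}.

Arguments mor {p} X Y.
Arguments idm {p} X.
Arguments mcomp {p X Y Z} g f.

Declare Scope cat_scope.
Delimit Scope cat_scope with cat.
Local Open Scope cat_scope.
Notation "g ∘ f" := (mcomp g f) (at level 40, left associativity) : cat_scope.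

Definition is_inverse (C : preaddCat) (X Y : C) (f : mor X Y) (g : mor Y X) :=
  g ∘ f = idm X /\ f ∘ g = idm Y.

Definition is_iso (C : preaddCat) (X Y : C) (f : mor X Y) :=
  exists g : mor Y X, is_inverse f g.

Definition isomorphic (C : preaddCat) (X Y : C) :=
  exists f : mor X Y, is_iso f.

Definition is_retract (C : preaddCat) (X Y : C) :=
  exists (s : mor X Y) (r : mor Y X), r ∘ s = idm X.

Definition is_zero (C : preaddCat) (Z : C) :=
  forall X : C, (forall f : mor X Z, f = 0) /\ (forall f : mor Z X, f = 0).

Definition is_coproduct (C : preaddCat) (I : Type) (F : I -> C) (X : C)
    (inj : forall i, mor (F i) X) :=
  forall (Y : C) (f : forall i, mor (F i) Y),
    exists! u : mor X Y, forall i, u ∘ inj i = f i.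

Record functor (C D : preaddCat) := Functor {
  fob :> C -> D;
  fmap : forall X Y : C, mor X Y -> mor (fob X) (fob Y);
  fmap1 : forall X : C, fmap (idm X) = idm (fob X);
  fmapM : forall (X Y Z : C) (g : mor Y Z) (f : mor X Y),
    fmap (g ∘ f) = fmap g ∘ fmap f
}.

Arguments fmap {C D} _ {X Y} _.

Definition fid (C : preaddCat) : functor C C :=
  @Functor C C id (fun X Y f => f) (fun X => erefl) (fun X Y Z g f => erefl).

Program Definition fcomp (C D E : preaddCat) (G : functor D E) (F : functor C D)
    : functor C E :=
  @Functor C E (fun X => G (F X)) (fun X Y f => fmap G (fmap F f)) _ _.
Next Obligation. by move=> *; rewrite !fmap1. Qed.
Next Obligation. by move=> *; rewrite !fmapM. Qed.

Fixpoint fiter (C : preaddCat) (F : functor C C) (n : nat) : functor C C :=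
  if n is m.+1 then fcomp F (fiter F m) else fid C.

Record addCat := AddCat {
  addcat_preadd :> preaddCat;
  zob : addcat_preadd;
  zobP : is_zero zob;
  addcat_coprod : forall n (F : 'I_n -> addcat_preadd),
    exists (X : addcat_preadd) (inj : forall i, mor (F i) X),
      is_coproduct inj
}.

Arguments zob {a}.

(* An additive category with an autoequivalence [sus] (the shift [1]), a      *)
(* chosen quasi-inverse [desus] (the shift [-1]), and a class [dist f g h] of *)
(* distinguished triangles X -f-> Y -g-> Z -h-> X[1].                         *)
Record triCat := TriCat {
  tricat_add :> addCat;

  sus : functor tricat_add tricat_add;
  susD : forall (X Y : tricat_add) (f g : mor X Y),
    fmap sus (f + g) = fmap sus f + fmap sus g;
  desus : functor tricat_add tricat_add;
  sus_unit : forall X : tricat_add, mor X (desus (sus X));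
  sus_unit_iso : forall X, is_iso (sus_unit X);
  sus_unit_nat : forall (X Y : tricat_add) (f : mor X Y),
    sus_unit Y ∘ f = fmap desus (fmap sus f) ∘ sus_unit X;
  sus_counit : forall X : tricat_add, mor (sus (desus X)) X;
  sus_counit_iso : forall X, is_iso (sus_counit X);
  sus_counit_nat : forall (X Y : tricat_add) (f : mor X Y),
    sus_counit Y ∘ fmap sus (fmap desus f) = f ∘ sus_counit X;

  dist : forall X Y Z : tricat_add,
    mor X Y -> mor Y Z -> mor Z (sus X) -> Prop;

  (* TR1 *)
  dist_iso : forall (X Y Z X' Y' Z' : tricat_add)
      (f : mor X Y) (g : mor Y Z) (h : mor Z (sus X))
      (f' : mor X' Y') (g' : mor Y' Z') (h' : mor Z' (sus X'))
      (u : mor X X') (v : mor Y Y') (w : mor Z Z'),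
    is_iso u -> is_iso v -> is_iso w ->
    v ∘ f = f' ∘ u -> w ∘ g = g' ∘ v -> fmap sus u ∘ h = h' ∘ w ->
    dist f g h -> dist f' g' h';
  dist_id : forall X : tricat_add,
    dist (idm X) (0 : mor X zob) (0 : mor zob (sus X));
  dist_cone : forall (X Y : tricat_add) (f : mor X Y),
    exists (Z : tricat_add) (g : mor Y Z) (h : mor Z (sus X)), dist f g h;
  (* TR2 *)
  dist_rot : forall (X Y Z : tricat_add)
      (f : mor X Y) (g : mor Y Z) (h : mor Z (sus X)),
    dist f g h <-> dist g h (- fmap sus f);
  (* TR3 *)
  dist_map : forall (X Y Z X' Y' Z' : tricat_add)
      (f : mor X Y) (g : mor Y Z) (h : mor Z (sus X))
      (f' : mor X' Y') (g' : mor Y' Z') (h' : mor Z' (sus X'))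
      (u : mor X X') (v : mor Y Y'),
    dist f g h -> dist f' g' h' -> v ∘ f = f' ∘ u ->
    exists w : mor Z Z', w ∘ g = g' ∘ v /\ fmap sus u ∘ h = h' ∘ w;
  (* TR4, the octahedral axiom *)
  dist_oct : forall (X Y Z Q1 Q2 Q3 : tricat_add)
      (f : mor X Y) (p1 : mor Y Q1) (d1 : mor Q1 (sus X))
      (g : mor Y Z) (p3 : mor Z Q3) (d3 : mor Q3 (sus Y))
      (p2 : mor Z Q2) (d2 : mor Q2 (sus X)),
    dist f p1 d1 -> dist g p3 d3 -> dist (g ∘ f) p2 d2 ->
    exists (a : mor Q1 Q2) (b : mor Q2 Q3),
      [/\ dist a b (fmap sus p1 ∘ d3),
          a ∘ p1 = p2 ∘ g /\ d1 = d2 ∘ a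
        & b ∘ p2 = p3 /\ fmap sus f ∘ d2 = d3 ∘ b]
}.

Arguments sus {t}.
Arguments desus {t}.
Arguments dist {t X Y Z} f g h.

(* E[n] is [shift n E]. *)
Definition shift (T : triCat) (n : int) : functor T T :=
  match n with
  | Posz m => fiter sus m
  | Negz m => fiter desus m.+1
  end.

Definition is_cone (T : triCat) (X Y : T) (f : mor X Y) (Z : T) :=
  exists (g : mor Y Z) (h : mor Z (sus X)), dist f g h.

(* S[n], made closed under isomorphism. *)
Definition shift_class (T : triCat) (S : T -> Prop) (n : int) (X : T) :=
  exists2 Y : T, S Y & isomorphic X (shift T n Y).

Record tStruct (T : triCat) := TStruct {
  aisle : T -> Prop;
  coaisle : T -> Prop;
  aisle_iso : forall X Y : T, isomorphic X Y -> aisle X -> aisle Y;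
  coaisle_iso : forall X Y : T, isomorphic X Y -> coaisle X -> coaisle Y;
  aisle_sub : forall X : T, aisle X -> shift_class aisle (- 1) X;
  coaisle_sub : forall X : T, shift_class coaisle (- 1) X -> coaisle X;
  tstruct_orth : forall (X Y : T) (f : mor X Y),
    aisle X -> shift_class coaisle (- 1) Y -> f = 0;
  tstruct_tri : forall X : T,
    exists (A B : T) (f : mor A X) (g : mor X B) (h : mor B (sus A)),
      [/\ aisle A, shift_class coaisle (- 1) B & dist f g h]
}.

Definition tle (T : triCat) (t : tStruct T) (n : int) : T -> Prop :=
  shift_class (aisle t) (- n).
Definition tge (T : triCat) (t : tStruct T) (n : int) : T -> Prop :=
  shift_class (coaisle t) (- n).

Definition bounded (T : triCat) (t : tStruct T) :=
  forall E : T, exists n : int, [/\ 0 < n, tle t n E & tge t (- n) E].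

(* The left (resp. right) adjoint to the inclusion of the full subcategory S, *)
(* built from a choice of universal arrows.                                   *)
Definition is_reflection (C : preaddCat) (S : C -> Prop) (X A : C)
    (u : mor X A) :=
  S A /\ forall (B : C) (f : mor X B), S B -> exists! g : mor A B, g ∘ u = f.

Definition is_coreflection (C : preaddCat) (S : C -> Prop) (X A : C)
    (u : mor A X) :=
  S A /\ forall (B : C) (f : mor B X), S B -> exists! g : mor B A, u ∘ g = f.

Definition reflective (C : preaddCat) (S : C -> Prop) :=
  forall X : C, exists (A : C) (u : mor X A), is_reflection S u.

Definition coreflective (C : preaddCat) (S : C -> Prop) :=
  forall X : C, exists (A : C) (u : mor A X), is_coreflection S u.

Section Reflector.
Variables (C : preaddCat) (S : C -> Prop) (SR : reflective S).

Definition refl_ob (X : C) : C := projT1 (cid (SR X)).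
Definition refl_unit (X : C) : mor X (refl_ob X) :=
  projT1 (cid (projT2 (cid (SR X)))).

Lemma refl_unitP X : is_reflection S (refl_unit X).
Proof. exact: projT2 (cid (projT2 (cid (SR X)))). Qed.

Lemma refl_map_ex (X Y : C) (f : mor X Y) :
  exists g : mor (refl_ob X) (refl_ob Y), g ∘ refl_unit X = refl_unit Y ∘ f.
Proof.
have [_ /(_ _ (refl_unit Y ∘ f) (proj1 (refl_unitP Y)))] := refl_unitP X.
by case=> g [gE _]; exists g.
Qed.

Definition refl_map (X Y : C) (f : mor X Y) : mor (refl_ob X) (refl_ob Y) :=
  projT1 (cid (refl_map_ex f)).

Lemma refl_mapE (X Y : C) (f : mor X Y) :
  refl_map f ∘ refl_unit X = refl_unit Y ∘ f.
Proof. exact: projT2 (cid (refl_map_ex f)). Qed.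

Lemma refl_inj (X B : C) (g g' : mor (refl_ob X) B) :
  S B -> g ∘ refl_unit X = g' ∘ refl_unit X -> g = g'.
Proof.
move=> SB e; have [_ /(_ _ (g ∘ refl_unit X) SB)[k [_ kU]]] := refl_unitP X.
by rewrite -(kU g) // -(kU g').
Qed.

Lemma refl_map1 X : refl_map (idm X) = idm (refl_ob X).
Proof.
apply: refl_inj; first by case: (refl_unitP X).
by rewrite refl_mapE compm1 comp1m.
Qed.

Lemma refl_mapM (X Y Z : C) (g : mor Y Z) (f : mor X Y) :
  refl_map (g ∘ f) = refl_map g ∘ refl_map f.
Proof.
apply: refl_inj; first by case: (refl_unitP Z).
by rewrite -compA !refl_mapE !compA refl_mapE.
Qed.

Definition reflector : functor C C := Functor refl_map1 refl_mapM.

End Reflector.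

Section Coreflector.
Variables (C : preaddCat) (S : C -> Prop) (SR : coreflective S).

Definition corefl_ob (X : C) : C := projT1 (cid (SR X)).
Definition corefl_counit (X : C) : mor (corefl_ob X) X :=
  projT1 (cid (projT2 (cid (SR X)))).

Lemma corefl_counitP X : is_coreflection S (corefl_counit X).
Proof. exact: projT2 (cid (projT2 (cid (SR X)))). Qed.

Lemma corefl_map_ex (X Y : C) (f : mor X Y) :
  exists g : mor (corefl_ob X) (corefl_ob Y),
    corefl_counit Y ∘ g = f ∘ corefl_counit X.
Proof.
have [_ /(_ _ (f ∘ corefl_counit X) (proj1 (corefl_counitP X)))] :=
  corefl_counitP Y.
by case=> g [gE _]; exists g.
Qed.

Definition corefl_map (X Y : C) (f : mor X Y) :
    mor (corefl_ob X) (corefl_ob Y) :=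
  projT1 (cid (corefl_map_ex f)).

Lemma corefl_mapE (X Y : C) (f : mor X Y) :
  corefl_counit Y ∘ corefl_map f = f ∘ corefl_counit X.
Proof. exact: projT2 (cid (corefl_map_ex f)). Qed.

Lemma corefl_inj (X B : C) (g g' : mor B (corefl_ob X)) :
  S B -> corefl_counit X ∘ g = corefl_counit X ∘ g' -> g = g'.
Proof.
move=> SB e.
have [_ /(_ _ (corefl_counit X ∘ g) SB)[k [_ kU]]] := corefl_counitP X.
by rewrite -(kU g) // -(kU g').
Qed.

Lemma corefl_map1 X : corefl_map (idm X) = idm (corefl_ob X).
Proof.
apply: corefl_inj; first by case: (corefl_counitP X).
by rewrite corefl_mapE compm1 comp1m.
Qed.

Lemma corefl_mapM (X Y Z : C) (g : mor Y Z) (f : mor X Y) :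
  corefl_map (g ∘ f) = corefl_map g ∘ corefl_map f.
Proof.
apply: corefl_inj; first by case: (corefl_counitP X).
by rewrite compA !corefl_mapE -!compA corefl_mapE.
Qed.

Definition coreflector : functor C C := Functor corefl_map1 corefl_mapM.

End Coreflector.

Section PreaddTheory.
Variable C : preaddCat.
Implicit Types X Y Z : C.

Lemma comp0m X Y Z (f : mor X Y) : (0 : mor Y Z) ∘ f = 0.
Proof. by apply: (addrI ((0 : mor Y Z) ∘ f)); rewrite -compDl !addr0. Qed.

Lemma compm0 X Y Z (g : mor Y Z) : g ∘ (0 : mor X Y) = 0.
Proof. by apply: (addrI (g ∘ (0 : mor X Y))); rewrite -compDr !addr0. Qed.

Lemma compNm X Y Z (g : mor Y Z) (f : mor X Y) : (- g) ∘ f = - (g ∘ f).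
Proof. by apply: (addrI (g ∘ f)); rewrite -compDl !subrr comp0m. Qed.

Lemma compmN X Y Z (g : mor Y Z) (f : mor X Y) : g ∘ (- f) = - (g ∘ f).
Proof. by apply: (addrI (g ∘ f)); rewrite -compDr !subrr compm0. Qed.

Lemma compBl X Y Z (g g' : mor Y Z) (f : mor X Y) :
  (g - g') ∘ f = g ∘ f - g' ∘ f.
Proof. by rewrite compDl compNm. Qed.

Lemma compBr X Y Z (g : mor Y Z) (f f' : mor X Y) :
  g ∘ (f - f') = g ∘ f - g ∘ f'.
Proof. by rewrite compDr compmN. Qed.

Lemma iso_id X : is_iso (idm X).
Proof. by exists (idm X); split; rewrite comp1m. Qed.

Lemma iso_monic X Y Z (u : mor Y Z) (f f' : mor X Y) :
  is_iso u -> u ∘ f = u ∘ f' -> f = f'.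
Proof.
case=> v [vu _] e; rewrite -[f]comp1m -[f']comp1m -vu.
by rewrite -!compA e.
Qed.

Lemma iso_epi X Y Z (u : mor X Y) (f f' : mor Y Z) :
  is_iso u -> f ∘ u = f' ∘ u -> f = f'.
Proof.
case=> v [_ uv] e; rewrite -[f]compm1 -[f']compm1 -uv.
by rewrite !compA e.
Qed.

Lemma isomorphic_sym X Y : isomorphic X Y -> isomorphic Y X.
Proof. by case=> f [g [gf fg]]; exists g, f; split. Qed.

Lemma isomorphic_trans X Y Z :
  isomorphic X Y -> isomorphic Y Z -> isomorphic X Z.
Proof.
case=> f [f' [f'f ff']] [g [g' [g'g gg']]]; exists (g ∘ f), (f' ∘ g'); split.
  by rewrite -compA (compA g') g'g comp1m.
by rewrite -compA (compA f) ff' comp1m.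
Qed.

Lemma isomorphic_fmap (F : functor C C) X Y :
  isomorphic X Y -> isomorphic (F X) (F Y).
Proof.
case=> f [g [gf fg]]; exists (fmap F f), (fmap F g).
by split; rewrite -fmapM ?gf ?fg fmap1.
Qed.

Lemma is_zeroP X : idm X = 0 -> is_zero X.
Proof.
move=> e Y; split=> f; first by rewrite -[f]comp1m e comp0m.
by rewrite -[f]compm1 e compm0.
Qed.

End PreaddTheory.

Section TriTheory.
Variable T : triCat.
Implicit Types X Y Z A B D : T.

Lemma sus_unsus X : isomorphic X (sus (desus X)).
Proof.
by apply: isomorphic_sym; exists (sus_counit X); apply: sus_counit_iso.
Qed.

Lemma desus_sus X : isomorphic X (desus (sus X)).
Proof. by exists (sus_unit X); apply: sus_unit_iso. Qed.

Lemma desus_inj X Y (f g : mor X Y) : fmap desus f = fmap desus g -> f = g.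
Proof.
move=> e; apply: (iso_epi (sus_counit_iso X)).
by rewrite -!sus_counit_nat e.
Qed.

Lemma sus_inj X Y (f g : mor X Y) : fmap sus f = fmap sus g -> f = g.
Proof.
move=> e; apply: (iso_monic (sus_unit_iso Y)).
by rewrite !sus_unit_nat e.
Qed.

Lemma sus_full X Y (w : mor (sus X) (sus Y)) :
  exists v : mor X Y, fmap sus v = w.
Proof.
have [i [iu ui]] := sus_unit_iso Y.
exists (i ∘ fmap desus w ∘ sus_unit X); apply: desus_inj.
apply: (iso_epi (sus_unit_iso X)); rewrite -sus_unit_nat.
by rewrite !compA ui comp1m.
Qed.

Lemma sus0 X Y : fmap sus (0 : mor X Y) = 0.
Proof. by apply: (addrI (fmap sus (0 : mor X Y))); rewrite -susD !addr0. Qed.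

Lemma sus_zob : is_zero (sus (zob : T)).
Proof. by apply: is_zeroP; rewrite -fmap1 (proj1 (zobP _) (idm _)) sus0. Qed.

Lemma dist_comp0 X Y Z (f : mor X Y) (g : mor Y Z) (h : mor Z (sus X)) :
  dist f g h -> g ∘ f = 0.
Proof.
move=> fgh; have [//|w [<- _]] := dist_map (u := idm X) (v := f) (dist_id X) fgh.
by rewrite compm0.
Qed.

Lemma dist_lift X Y Z (f : mor X Y) (g : mor Y Z) (h : mor Z (sus X)) D
    (u : mor D Y) :
  dist f g h -> g ∘ u = 0 -> exists v : mor D X, f ∘ v = u.
Proof.
move=> /dist_rot fgh gu; have /dist_rot Did := dist_id D.
have [|w [_]] := dist_map (u := u) (v := 0 : mor zob Z) Did fgh.
  by rewrite gu comp0m.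
rewrite fmap1 compmN compm1 compNm => /oppr_inj e.
have [v vw] := sus_full w; exists v; apply: sus_inj.
by rewrite fmapM vw.
Qed.

Lemma dist_0id D : dist (0 : mor zob D) (idm D) (0 : mor D (sus zob)).
Proof.
apply/dist_rot; rewrite sus0 oppr0.
have wiso : is_iso (0 : mor (zob : T) (sus zob)).
  exists 0; split; first by rewrite compm0 (proj1 (zobP _) (idm _)).
  by rewrite compm0 (proj1 (sus_zob _) (idm _)).
apply: (dist_iso (iso_id D) (iso_id D) wiso _ _ _ (dist_id D)).
- by [].
- by rewrite compm0 comp0m.
- by rewrite compm0 comp0m.
Qed.

Lemma dist_ext X Y Z (f : mor X Y) (g : mor Y Z) (h : mor Z (sus X)) D
    (u : mor Y D) :
  dist f g h -> u ∘ f = 0 -> exists v : mor Z D, v ∘ g = u.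
Proof.
move=> fgh uf.
have [|w [e _]] := dist_map (u := 0 : mor X zob) (v := u) fgh (dist_0id D).
  by rewrite uf comp0m.
by exists w; rewrite e comp1m.
Qed.

Variable t : tStruct T.

Lemma aisle_sus X : aisle t X -> aisle t (sus X).
Proof.
case/aisle_sub=> Y aY XY; apply: aisle_iso aY; apply: isomorphic_sym.
apply: isomorphic_trans (isomorphic_fmap sus XY) _.
exact/isomorphic_sym/sus_unsus.
Qed.

Lemma coaisle_sus X : shift_class (coaisle t) (- 1) X -> coaisle t (sus X).
Proof.
case=> Y aY XY; apply: coaisle_iso aY; apply: isomorphic_sym.
apply: isomorphic_trans (isomorphic_fmap sus XY) _.
exact/isomorphic_sym/sus_unsus.
Qed.

Lemma aisle_coreflective : coreflective (aisle t).
Proof.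
move=> X; have [A [B [f [g [h [aA cB fgh]]]]]] := tstruct_tri t X.
exists A, f; split=> // D u aD.
have [v fv] := dist_lift fgh (tstruct_orth (g ∘ u) aD cB).
exists v; split=> // v' fv'; apply/eqP; rewrite -subr_eq0; apply/eqP.
have fvv : fmap sus f ∘ fmap sus (v - v') = 0.
  by rewrite -fmapM compBr fv fv' subrr sus0.
have fgh2 := proj1 (dist_rot _ _ _) (proj1 (dist_rot _ _ _) fgh).
have [|w hw] := dist_lift (u := fmap sus (v - v')) fgh2.
  by rewrite compNm fvv oppr0.
apply: sus_inj; rewrite sus0 -hw.
by rewrite (tstruct_orth w (aisle_sus aD) cB) compm0.
Qed.

Lemma coaisle1_reflective : reflective (shift_class (coaisle t) (- 1)).
Proof.
move=> X; have [A [B [f [g [h [aA cB fgh]]]]]] := tstruct_tri t X.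
exists B, g; split=> // D u cD.
have [v vg] := dist_ext fgh (tstruct_orth (u ∘ f) aA cD).
exists v; split=> // v' v'g; apply/eqP; rewrite -subr_eq0; apply/eqP.
have vv : (v - v') ∘ g = 0 by rewrite compBl vg v'g subrr.
have [w <-] := dist_ext (proj1 (dist_rot _ _ _) fgh) vv.
by rewrite (tstruct_orth w (aisle_sus aA) cD) comp0m.
Qed.

Lemma coaisle_reflective : reflective (coaisle t).
Proof.
move=> X; have [B [r [cB rU]]] := coaisle1_reflective (desus X).
have [e [ec ce]] := sus_counit_iso X.
exists (sus B), (fmap sus r ∘ e); split; first exact: coaisle_sus.
move=> D u cD; have cD1 : shift_class (coaisle t) (- 1) (desus D).
  by exists D => //; exists (idm _); apply: iso_id.
have [g [gr gU]] := rU _ (fmap desus u) cD1.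
have E : sus_counit D ∘ fmap sus g ∘ (fmap sus r ∘ e) = u.
  rewrite compA -(compA (sus_counit D)) -fmapM gr sus_counit_nat.
  by rewrite -compA ce compm1.
exists (sus_counit D ∘ fmap sus g); split=> // k kE.
move: E; set k' := sus_counit D ∘ fmap sus g => k'E.
clearbody k'.
have {kE k'E} kk : k ∘ fmap sus r = k' ∘ fmap sus r.
  have: k ∘ fmap sus r ∘ e = k' ∘ fmap sus r ∘ e by rewrite -!compA kE k'E.
  by apply: iso_epi; exists (sus_counit X); split.
apply/esym; apply: desus_inj; apply: (iso_epi (sus_unit_iso B)).
have [g0 [_ g0U]] := rU _ (fmap desus k ∘ sus_unit B ∘ r) cD1.
rewrite -[LHS]g0U // -[RHS]g0U //.
by rewrite -!compA sus_unit_nat !compA -!fmapM kk.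
Qed.

End TriTheory.

Definition tau_le0 (T : triCat) (t : tStruct T) : functor T T :=
  coreflector (aisle_coreflective t).

Definition tau_ge0 (T : triCat) (t : tStruct T) : functor T T :=
  reflector (coaisle_reflective t).

(* H^n, composed with the inclusion of the heart (a full subcategory) in T.   *)
Definition cohom (T : triCat) (t : tStruct T) (n : int) : functor T T :=
  fcomp (tau_le0 t) (fcomp (tau_ge0 t) (shift T n)).

Definition iso_in_degrees_ge (T : triCat) (t : tStruct T) (a : int)
    (X Y : T) (f : mor X Y) :=
  forall n : int, a <= n -> is_iso (fmap (cohom t n) f).

Inductive add_closure (T : triCat) (S : T -> Prop) : T -> Prop :=
| add_gen X of S X : add_closure S X
| add_iso X Y of add_closure S X & isomorphic X Y : add_closure S Y
| add_shift X (n : int) of add_closure S X : add_closure S (shift T n X)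
| add_coprod n (F : 'I_n -> T) X (inj : forall i, mor (F i) X)
    of is_coproduct inj & (forall i, add_closure S (F i)) : add_closure S X
| add_retract X Y of add_closure S Y & is_retract X Y : add_closure S X.

(* <S>_n *)
Fixpoint gen_level (T : triCat) (S : T -> Prop) (n : nat) : T -> Prop :=
  match n with
  | 0 => fun X => isomorphic X zob
  | 1 => add_closure S
  | m.+1 => add_closure (fun C => exists (A B : T) (phi : mor A B),
      [/\ gen_level S m A, add_closure S B & is_cone phi C])
  end.

(* Main.v *)
From mathcomp Require Import all_boot all_order all_algebra.
From mathcomp Require Import zify.
Require Import Defs.

(** Only (2) => (1) needs an argument.  Write T>=m and T<=m for the two halves
    of the t-structure.  Given E, the approximation f : X -> E with X in P is
    an isomorphism in degrees >= a, and a may be chosen very negative.  Two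
    facts turn E into a retract of an object of <G>_d.

    First ([iso_in_degrees_ge_equiv]), maps X -> D with D in T>=a extend
    uniquely along f.  This says that f becomes an isomorphism after truncation
    to degrees >= a.  It is proved by descending induction on the degree; the
    bounds on X and E start the induction, and the step is the five lemma
    applied to the triangles H^n[-n] -> tau_>=n -> tau_>=n+1 of X and E.

    Second ([gen_level_amplitude]), there is an integer b, depending only on G
    and d, such that for every m each map from an object of <G>_d to an object
    of T>=m factors through an object of <G>_d that lies in T>=(m - b).  For
    d = 1 this holds because a shift G[k] either has no nonzero map to T>=m or
    already lies in T>=(m - b), with b twice a bound for G.  The induction on d
    is the factorization for cones, [amplitude_cone].

    Now take E in T>=(-n) and a = - n - b.  The map f factors as
    X -s-> Q -w-> E with Q in <G>_d and in T>=a.  By the first fact s = v f for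
    some v : E -> Q.  Then (w v) f = f, and uniqueness of extensions gives
    w v = id, so E is a retract of Q.  The choice of a is possible because b
    does not depend on X. *)

Set Implicit Arguments.
Unset Strict Implicit.
Unset Printing Implicit Defensive.

Import Order.TTheory GRing.Theory Num.Theory.
Local Open Scope ring_scope.
Local Open Scope cat_scope.

(** * Shift functors *)

Section Shift.
Variable T : triCat.
Implicit Types X Y Z : T.

Lemma desus_full X Y (w : mor (desus X) (desus Y)) :
  exists v : mor X Y, fmap desus v = w.
Proof.
have [i [ic ci]] := sus_counit_iso X.
exists (sus_counit Y ∘ fmap sus w ∘ i); apply: sus_inj.
apply: (iso_monic (sus_counit_iso Y)).
by rewrite sus_counit_nat -compA ic compm1.
Qed.

Lemma fiter_inj (F : functor T T) n :
  (forall X Y (f g : mor X Y), fmap F f = fmap F g -> f = g) ->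
  forall X Y (f g : mor X Y), fmap (fiter F n) f = fmap (fiter F n) g -> f = g.
Proof. by move=> FI; elim: n => //= n IH X Y f g /FI /IH. Qed.

Lemma fiter_full (F : functor T T) n :
  (forall X Y (w : mor (F X) (F Y)), exists v, fmap F v = w) ->
  forall X Y (w : mor (fiter F n X) (fiter F n Y)),
    exists v, fmap (fiter F n) v = w.
Proof.
move=> FF; elim: n => [|n IH] X Y w /=; first by exists w.
by have [v <-] := FF _ _ w; have [u <-] := IH _ _ v; exists u.
Qed.

Lemma shift_inj n X Y (f g : mor X Y) :
  fmap (shift T n) f = fmap (shift T n) g -> f = g.
Proof.
case: n => n; first exact: fiter_inj (@sus_inj T) X Y f g.
exact: (@fiter_inj desus n.+1 (@desus_inj T) X Y f g).
Qed.

Lemma shift_full n X Y (w : mor (shift T n X) (shift T n Y)) :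
  exists v, fmap (shift T n) v = w.
Proof.
case: n w => n w; first exact: fiter_full (@sus_full T) X Y w.
exact: (@fiter_full desus n.+1 desus_full X Y w).
Qed.

Lemma isomorphic_refl X : isomorphic X X.
Proof. by exists (idm X); apply: iso_id. Qed.

Lemma shift_succ n X : isomorphic (shift T (n + 1) X) (sus (shift T n X)).
Proof.
case: n => [m|[|m]].
- by rewrite -PoszD addn1; apply: isomorphic_refl.
- exact: sus_unsus.
- by rewrite (_ : Negz m.+1 + 1 = Negz m); [apply: sus_unsus | lia].
Qed.

Lemma shift_pred n X : isomorphic (shift T (n - 1) X) (desus (shift T n X)).
Proof.
apply: isomorphic_trans (desus_sus _) _.
apply: isomorphic_fmap; apply: isomorphic_sym.
by have := shift_succ (n - 1) X; rewrite subrK.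
Qed.

Lemma shift_add n m X :
  isomorphic (shift T n (shift T m X)) (shift T (m + n) X).
Proof.
elim/int_ind: n => [|n IH|n IH].
- by rewrite addr0; apply: isomorphic_refl.
- change (isomorphic (sus (shift T n (shift T m X))) (shift T (m + n.+1) X)).
  rewrite (_ : m + n.+1%:Z = m + n%:Z + 1); last by lia.
  apply: isomorphic_trans (isomorphic_fmap sus IH) _.
  exact/isomorphic_sym/shift_succ.
- rewrite (_ : - n.+1%:Z = - n%:Z - 1); last by lia.
  rewrite addrA.
  apply: isomorphic_trans (shift_pred _ _) _.
  apply: isomorphic_trans (isomorphic_fmap desus IH) _.
  exact/isomorphic_sym/shift_pred.
Qed.

Lemma shiftK n X : isomorphic (shift T n (shift T (- n) X)) X.
Proof.
by have := shift_add n (- n) X; rewrite addNr.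
Qed.

(** This stands in for the adjunction between E[n] and E[-n]: it moves a
    factorization problem for X[n] -> Y to one for X -> Y[-n]. *)
Lemma shift_map_to n X Y (f : mor (shift T n X) Y) :
  exists (i : mor (shift T n (shift T (- n) Y)) Y)
         (v : mor X (shift T (- n) Y)),
    is_iso i /\ f = i ∘ fmap (shift T n) v.
Proof.
have [i ii] := shiftK n Y; have [j [ji ij]] := ii.
have [v vE] := shift_full (j ∘ f).
by exists i, v; split=> //; rewrite vE compA ij comp1m.
Qed.

Lemma desus0 X Y : fmap desus (0 : mor X Y) = 0.
Proof.
apply: sus_inj; apply: (iso_monic (sus_counit_iso Y)).
by rewrite sus_counit_nat sus0 comp0m compm0.
Qed.

Lemma shift0 n X Y : fmap (shift T n) (0 : mor X Y) = 0.
Proof.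
case: n => n; first by elim: n => //= n ->; rewrite sus0.
by rewrite /shift; elim: n.+1 => //= k ->; rewrite desus0.
Qed.

End Shift.

(** * Diagram chases in triangles *)

Section Triangles.
Variable T : triCat.
Implicit Types X Y Z D : T.

Lemma dist_comp0r X Y Z (f : mor X Y) (g : mor Y Z) (h : mor Z (sus X)) :
  dist f g h -> h ∘ g = 0.
Proof. by move/dist_rot/dist_comp0. Qed.

Lemma dist_sus_comp0 X Y Z (f : mor X Y) (g : mor Y Z) (h : mor Z (sus X)) :
  dist f g h -> fmap sus f ∘ h = 0.
Proof.
move/dist_rot/dist_rot/dist_comp0; rewrite compNm => e.
by rewrite -[LHS]opprK e oppr0.
Qed.

Lemma dist_lift_cone X Y Z (f : mor X Y) (g : mor Y Z) (h : mor Z (sus X)) D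
    (u : mor D Z) :
  dist f g h -> h ∘ u = 0 -> exists v : mor D Y, g ∘ v = u.
Proof. by move/dist_rot; apply: dist_lift. Qed.

Lemma dist_lift_sus X Y Z (f : mor X Y) (g : mor Y Z) (h : mor Z (sus X)) D
    (u : mor D (sus X)) :
  dist f g h -> fmap sus f ∘ u = 0 -> exists v : mor D Z, h ∘ v = u.
Proof.
move/dist_rot/dist_rot => d e; apply: (dist_lift d).
by rewrite compNm e oppr0.
Qed.

Lemma dist_fiber X Y (g : mor X Y) :
  exists (F : T) (f : mor F X) (h : mor Y (sus F)), dist f g h.
Proof.
have [Z [p [q d]]] := dist_cone g.
have [k [ck kc]] := sus_counit_iso Z.
have [f fE] := sus_full (- (q ∘ sus_counit Z)).
exists (desus Z), f, (k ∘ p); apply/dist_rot; rewrite fE opprK.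
apply: (dist_iso (u := idm X) (v := idm Y) (w := k)) d.
- exact: iso_id.
- exact: iso_id.
- by exists (sus_counit Z).
- by rewrite compm1 comp1m.
- by rewrite compm1.
- by rewrite fmap1 comp1m -compA kc compm1.
Qed.

(** The five lemma in its middle position, which avoids the signs that rotating
    the other versions would introduce.  The chase uses generalized elements of
    Y and Y': [v] is injective on them, and lifting the identity of Y' yields a
    section, which injectivity turns into an inverse. *)
Lemma dist_map_iso X Y Z X' Y' Z'
    (f : mor X Y) (g : mor Y Z) (h : mor Z (sus X))
    (f' : mor X' Y') (g' : mor Y' Z') (h' : mor Z' (sus X'))
    (u : mor X X') (v : mor Y Y') (w : mor Z Z') :
  dist f g h -> dist f' g' h' ->
  v ∘ f = f' ∘ u -> w ∘ g = g' ∘ v -> fmap sus u ∘ h = h' ∘ w ->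
  is_iso u -> is_iso w -> is_iso v.
Proof.
move=> d d' vf wg uh iu iw.
have isu : is_iso (fmap sus u).
  by case: iu => x [xu ux]; exists (fmap sus x); split;
     rewrite -fmapM ?xu ?ux fmap1.
have inj D (y : mor D Y) : v ∘ y = 0 -> y = 0.
  move=> vy; have gy : g ∘ y = 0.
    by apply: (iso_monic iw); rewrite compA wg -compA vy !compm0.
  have [x xE] := dist_lift d gy.
  have fux : fmap sus f' ∘ fmap sus (u ∘ x) = 0.
    by rewrite -fmapM compA -vf -compA xE vy sus0.
  have [z' z'E] := dist_lift_sus d' fux.
  case: (iw) => w' [_ ww'].
  have sx : fmap sus x = h ∘ (w' ∘ z').
    apply: (iso_monic isu); rewrite -fmapM -z'E compA uh -compA (compA w) ww'.
    by rewrite comp1m.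
  by apply: sus_inj; rewrite -xE fmapM sx compA (dist_sus_comp0 d) comp0m sus0.
have [s vs] : exists s : mor Y' Y, v ∘ s = idm Y'.
  case: (iw) => w' [_ ww']; case: (iu) => u' [_ uu'].
  have hz : h ∘ (w' ∘ g') = 0.
    apply: (iso_monic isu); rewrite compA uh -compA (compA w) ww' comp1m.
    by rewrite (dist_comp0r d') compm0.
  have [y yE] := dist_lift_cone d hz.
  have e : g' ∘ (idm Y' - v ∘ y) = 0.
    by rewrite compBr compm1 compA -wg -compA yE compA ww' comp1m subrr.
  have [x' x'E] := dist_lift d' e.
  exists (y + f ∘ (u' ∘ x')).
  rewrite compDr (compA v f) vf -(compA f' u) (compA u) uu' comp1m x'E.
  by rewrite addrC subrK.
exists s; split=> //; apply/eqP; rewrite -subr_eq0; apply/eqP; apply: inj.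
by rewrite compBr compm1 compA vs comp1m subrr.
Qed.

End Triangles.

(** * Aisles and coaisles in each degree *)

Section TStructure.
Variables (T : triCat) (t : tStruct T).
Implicit Types X Y Z D : T.

Lemma shift_classP (S : T -> Prop) n X :
  (forall X Y, isomorphic X Y -> S X -> S Y) ->
  shift_class S (- n) X <-> S (shift T n X).
Proof.
move=> Siso; split.
  case=> Y SY XY; apply: Siso SY; apply: isomorphic_sym.
  exact: isomorphic_trans (isomorphic_fmap _ XY) (shiftK _ _).
move=> SX; exists (shift T n X) => //; apply: isomorphic_sym.
by have := shiftK (- n) X; rewrite opprK.
Qed.

Lemma tleE n X : tle t n X <-> aisle t (shift T n X).
Proof. exact: shift_classP (@aisle_iso _ t). Qed.

Lemma tgeE n X : tge t n X <-> coaisle t (shift T n X).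
Proof. exact: shift_classP (@coaisle_iso _ t). Qed.

Lemma tge_iso n X Y : isomorphic X Y -> tge t n X -> tge t n Y.
Proof.
by move=> XY /tgeE a; apply/tgeE; apply: coaisle_iso a; apply: isomorphic_fmap.
Qed.

Lemma tle_shift n m X : tle t n (shift T m X) <-> tle t (m + n) X.
Proof.
split=> /tleE a; apply/tleE; apply: aisle_iso a; first exact: shift_add.
exact/isomorphic_sym/shift_add.
Qed.

Lemma tge_shift n m X : tge t n (shift T m X) <-> tge t (m + n) X.
Proof.
split=> /tgeE a; apply/tgeE; apply: coaisle_iso a; first exact: shift_add.
exact/isomorphic_sym/shift_add.
Qed.

Lemma tle_mono n m X : n <= m -> tle t n X -> tle t m X.
Proof.
move=> nm; have [k ->] : exists k : nat, m = n + k%:Z by exists `|m - n|%N; lia.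
elim: k => [|k IH] a; first by rewrite addr0.
move/IH: a => /tleE a; apply/tleE.
rewrite (_ : n + k.+1%:Z = n + k%:Z + 1); last by lia.
apply: aisle_iso (aisle_sus a).
exact/isomorphic_sym/shift_succ.
Qed.

(** The truncation triangle A -> X -> B has first map zero, so A[1] -> B has a
    retraction; that map is also zero by orthogonality, hence A[1] = 0 and
    X -> B is an isomorphism. *)
Lemma tge1_orth X : (forall A (f : mor A X), aisle t A -> f = 0) -> tge t 1 X.
Proof.
move=> X0; have [A [B [f [g [h [aA cB d]]]]]] := tstruct_tri t X.
have f0 := X0 _ f aA.
have [s hs] : exists s, h ∘ s = idm (sus A).
  by apply: (dist_lift_sus d); rewrite f0 sus0 comp0m.
have sA0 : idm (sus A) = 0.
  by rewrite -hs (tstruct_orth s (aisle_sus aA) cB) compm0.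
have [v vg] : exists v, v ∘ g = idm X.
  by apply: (dist_ext d); rewrite f0 compm0.
apply: tge_iso cB; exists v, g; split=> //.
apply/eqP; rewrite -subr_eq0; apply/eqP.
have [|w <-] := dist_ext (u := g ∘ v - idm B) (proj1 (dist_rot _ _ _) d).
  by rewrite compBl comp1m -compA vg compm1 subrr.
by rewrite -[h]comp1m sA0 comp0m compm0.
Qed.

(** From this orthogonality the closure of T>=n under extensions and finite
    coproducts is immediate. *)
Lemma tgeP n X :
  tge t n X <-> forall D (f : mor D X), tle t (n - 1) D -> f = 0.
Proof.
have sh : tge t n X <-> tge t 1 (shift T (n - 1) X).
  by have := tge_shift 1 (n - 1) X; rewrite subrK => -[a b]; split.
split=> [/sh c D f /tleE a|X0].
  by apply: (@shift_inj _ (n - 1)); rewrite shift0; apply: tstruct_orth c.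
apply/sh; apply: tge1_orth => A f aA.
have [i ii] := shiftK (n - 1) A; have [v vE] := shift_full (f ∘ i).
apply: (iso_epi ii); rewrite -vE comp0m (X0 _ v) ?shift0 //.
by apply/tle_shift; rewrite addNr; apply/tleE.
Qed.

Lemma tge_mono n m X : m <= n -> tge t n X -> tge t m X.
Proof.
move=> mn /tgeP X0; apply/tgeP => D f aD; apply: X0.
by apply: tle_mono aD; lia.
Qed.

Lemma tge_sus n X : tge t n X -> tge t (n - 1) (sus X).
Proof.
by move=> a; apply: (proj2 (tge_shift (n - 1) 1 X)); rewrite addrC subrK.
Qed.

Lemma tge_zob n : tge t n (zob : T).
Proof. by apply/tgeP => D f _; apply: (proj1 (zobP _)). Qed.

Lemma tge_ext n X Y Z (f : mor X Y) (g : mor Y Z) (h : mor Z (sus X)) :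
  dist f g h -> tge t n X -> tge t n Z -> tge t n Y.
Proof.
move=> d /tgeP X0 /tgeP Z0; apply/tgeP => D u aD.
by have [v <-] := dist_lift d (Z0 _ (g ∘ u) aD); rewrite (X0 _ v aD) compm0.
Qed.

Lemma tge_cone n X Y Z (f : mor X Y) (g : mor Y Z) (h : mor Z (sus X)) :
  dist f g h -> tge t n Y -> tge t (n + 1) X -> tge t n Z.
Proof.
move=> /dist_rot d cY cX; apply: tge_ext d cY _.
by have := tge_sus cX; rewrite addrK.
Qed.

Lemma tge_fiber n X Y Z (f : mor X Y) (g : mor Y Z) (h : mor Z (sus X)) :
  dist f g h -> tge t n Y -> tge t (n - 1) Z -> tge t n X.
Proof.
move=> /dist_rot/dist_rot d cY cZ; have := tge_ext d cZ (tge_sus cY).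
by move/(proj1 (tge_shift (n - 1) 1 X)); rewrite addrC subrK.
Qed.

(** * Maps inducing isomorphisms in high degrees *)

(** The property that tau_>=n f is an isomorphism, phrased through maps
    into T>=n so that no truncation functor other than the one in degree 0 has
    to be constructed. *)
Definition tge_equiv n X Y (f : mor X Y) :=
  forall D, tge t n D -> forall u : mor X D, exists! v : mor Y D, v ∘ f = u.

Lemma tge_equivP n X Y (f : mor X Y) D (v v' : mor Y D) :
  tge_equiv n f -> tge t n D -> v ∘ f = v' ∘ f -> v = v'.
Proof.
move=> ef cD e; have [w [_ wU]] := ef _ cD (v ∘ f).
by rewrite -(wU v) // -(wU v').
Qed.

Lemma tge_equiv_shift n m X Y (f : mor X Y) :
  tge_equiv n (fmap (shift T m) f) <-> tge_equiv (m + n) f.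
Proof.
split=> ef D cD u.
  have cD' : tge t n (shift T m D) by apply/tge_shift.
  have [v [vE vU]] := ef _ cD' (fmap (shift T m) u).
  have [w wE] := shift_full v.
  exists w; split=> [|w' w'E].
    by apply: (@shift_inj _ m); rewrite fmapM wE.
  by apply: (@shift_inj _ m); rewrite wE; apply: vU; rewrite -fmapM w'E.
have [i ii] := shiftK m D; have [j [ji ij]] := ii.
have cD' : tge t (m + n) (shift T (- m) D).
  by apply/tge_shift; rewrite addKr.
have [u' u'E] := shift_full (j ∘ u).
have [v [vE vU]] := ef _ cD' u'.
exists (i ∘ fmap (shift T m) v); split.
  by rewrite -compA -fmapM vE u'E compA ij comp1m.
move=> w wE; have [w' w'E] := shift_full (j ∘ w).
rewrite (vU w'); first by rewrite w'E compA ij comp1m.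
by apply: (@shift_inj _ m); rewrite fmapM w'E u'E -compA wE.
Qed.

(** A t-structure only provides some truncation triangle; transporting it along
    the isomorphism between two coreflections puts the chosen functor tau_<=0 in
    its first place, which is what [cohom] is built from. *)
Lemma coreflection_triangle X :
  exists B (g : mor X B) (h : mor B (sus (tau_le0 t X))),
    tge t 1 B /\ dist (corefl_counit (aisle_coreflective t) X) g h.
Proof.
have [A [B [f [g [h [aA cB d]]]]]] := tstruct_tri t X.
set c := corefl_counit _ _.
have [aC cU] : is_coreflection (aisle t) c := corefl_counitP _ _.
have [a [aE aU]] := cU _ f aA.
have [b bE] := dist_lift d (tstruct_orth (g ∘ c) aC cB).
have ab : a ∘ b = idm _.
  by apply: (corefl_inj (SR := aisle_coreflective t) aC);
     rewrite compA aE bE compm1.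
have ba : b ∘ a = idm _.
  apply/eqP; rewrite -subr_eq0; apply/eqP; apply: sus_inj; rewrite sus0.
  have [|w <-] := dist_lift_sus (u := fmap sus (b ∘ a - idm A)) d.
    by rewrite -fmapM compBr compA bE aE compm1 subrr sus0.
  by rewrite (tstruct_orth w (aisle_sus aA) cB) compm0.
exists B, g, (fmap sus a ∘ h); split=> //.
apply: (dist_iso (u := a) (v := idm X) (w := idm B)) d.
- by exists b.
- exact: iso_id.
- exact: iso_id.
- by rewrite comp1m aE.
- by rewrite comp1m compm1.
- by rewrite compm1.
Qed.

Lemma coreflection_triangle_epi X B D (g : mor X B)
    (h : mor B (sus (tau_le0 t X))) (p q : mor B D) :
  dist (corefl_counit (aisle_coreflective t) X) g h -> tge t 1 D ->
  p ∘ g = q ∘ g -> p = q.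
Proof.
move=> d cD e; apply/eqP; rewrite -subr_eq0; apply/eqP.
have [|k <-] := dist_ext (u := p - q) (proj1 (dist_rot _ _ _) d).
  by rewrite compBl e subrr.
rewrite (tstruct_orth k (aisle_sus _) cD) ?comp0m //.
exact: (proj1 (corefl_counitP _ _)).
Qed.

(** The two hypotheses say that f is an isomorphism on tau_>=1 and on tau_<=0,
    so the five lemma applies to the truncation triangles. *)
Lemma tge1_equiv_iso X Y (f : mor X Y) :
  tge_equiv 1 f -> is_iso (fmap (tau_le0 t) f) -> is_iso f.
Proof.
move=> ef iu.
have [BX [gX [hX [cX dX]]]] := coreflection_triangle X.
have [BY [gY [hY [cY dY]]]] := coreflection_triangle Y.
have sq : f ∘ corefl_counit (aisle_coreflective t) X
    = corefl_counit (aisle_coreflective t) Y ∘ fmap (tau_le0 t) f.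
  by rewrite /= corefl_mapE.
have aY : aisle t (tau_le0 t Y) := proj1 (corefl_counitP _ _).
have [w [wg wh]] := dist_map dX dY sq.
apply: (dist_map_iso dX dY sq wg wh iu).
(* The inverse of w is the map induced on BY by the extension of gX along f. *)
have [v [vE _]] := ef _ cX gX.
have [w' w'E] := dist_ext dY (tstruct_orth (v ∘ _) aY cX).
exists w'; split.
  apply: (coreflection_triangle_epi dX cX).
  by rewrite comp1m -compA wg compA w'E.
apply: (coreflection_triangle_epi dY cY); rewrite comp1m -compA w'E.
by apply: (tge_equivP ef cY); rewrite -compA vE.
Qed.

Lemma tge0E X : tge t 0 X <-> coaisle t X.
Proof. exact: tgeE. Qed.

Lemma tge_equiv_reflector n X Y (f : mor X Y) :
  0 <= n -> tge_equiv n f -> tge_equiv n (fmap (tau_ge0 t) f).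
Proof.
move=> n0 ef D cD u /=.
have cD0 : coaisle t D by apply/tge0E; apply: tge_mono cD.
have [v [vE vU]] := ef _ cD (u ∘ refl_unit (coaisle_reflective t) X).
have [_ /(_ _ v cD0)[w [wE wU]]] := refl_unitP (coaisle_reflective t) Y.
exists w; split.
  by apply: refl_inj => //; rewrite -compA refl_mapE compA wE.
move=> w' w'E; apply: wU; apply/esym; apply: vU.
by rewrite -compA -refl_mapE compA w'E.
Qed.

Lemma tge_equiv_of_reflector X Y (f : mor X Y) :
  is_iso (fmap (tau_ge0 t) f) -> tge_equiv 0 f.
Proof.
case=> k /= [kf fk] D /tge0E cD u.
have [_ /(_ _ u cD)[w [wE wU]]] := refl_unitP (coaisle_reflective t) X.
exists (w ∘ k ∘ refl_unit (coaisle_reflective t) Y); split.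
  by rewrite -compA -refl_mapE compA -(compA w) kf compm1.
move=> v vE.
have [_ /(_ _ v cD)[v' [v'E _]]] := refl_unitP (coaisle_reflective t) Y.
rewrite -v'E; congr (_ ∘ _).
rewrite (wU (v' ∘ refl_map (coaisle_reflective t) f)).
  by rewrite -compA fk compm1.
by rewrite -compA refl_mapE compA v'E.
Qed.

Lemma tge_equiv_step n X Y (f : mor X Y) :
  tge_equiv (n + 1) f -> is_iso (fmap (cohom t n) f) -> tge_equiv n f.
Proof.
move=> /tge_equiv_shift ef iH.
rewrite -[n]addr0; apply/tge_equiv_shift/tge_equiv_of_reflector.
exact: tge1_equiv_iso (tge_equiv_reflector _ ef) iH.
Qed.

(** Descending induction from a degree above both X and Y, where all Hom-groups
    involved vanish. *)
Lemma iso_in_degrees_ge_equiv (tb : bounded t) a X Y (f : mor X Y) :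
  iso_in_degrees_ge t a f -> tge_equiv a f.
Proof.
move=> iH; have [n [_ aX _]] := tb X; have [m [_ aY _]] := tb Y.
pose j := (`|n| + `|m| + `|a| + 1)%N.
suff: tge_equiv (a + j%:Z) f.
  elim: j => [|j IH] ef; first by rewrite addr0 in ef.
  apply: IH; apply: tge_equiv_step; last by apply: iH; lia.
  by rewrite -addrA -PoszD addn1.
move=> D /tgeP cD u; exists 0; split.
  by rewrite comp0m (cD _ u) //; apply: tle_mono aX; lia.
by move=> v _; rewrite (cD _ v) //; apply: tle_mono aY; lia.
Qed.

End TStructure.

(** * Finite sums *)

Section Sums.
Variable T : triCat.
Implicit Types X Y Z D : T.

Lemma comp_sumr X Y Z (I : finType) (g : mor Y Z) (f : I -> mor X Y) :
  g ∘ (\sum_i f i) = \sum_i g ∘ f i.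
Proof. by apply: (big_morph (mcomp g)); [apply: compDr | apply: compm0]. Qed.

Lemma comp_suml X Y Z (I : finType) (g : I -> mor Y Z) (f : mor X Y) :
  (\sum_i g i) ∘ f = \sum_i g i ∘ f.
Proof.
apply: (big_morph (fun k => k ∘ f)); last exact: comp0m.
by move=> p q; apply: compDl.
Qed.

(** Finite coproducts are biproducts; the projections exist because of the
    zero maps between different summands. *)
Lemma coproduct_resolution n (F : 'I_n -> T) X (inj : forall i, mor (F i) X) :
  is_coproduct inj ->
  exists p : forall i, mor X (F i), \sum_i inj i ∘ p i = idm X.
Proof.
move=> cp.
have pex i : exists p : mor X (F i),
    forall k, inj i ∘ p ∘ inj k = if k == i then inj k else 0.
  (* Kronecker delta; the cast is needed since F k and F i are equal only after
     comparing k with i. *)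
  pose e k : mor (F k) (F i) :=
    match k =P i with
    | ReflectT E => ecast z (mor (F k) (F z)) E (idm (F k))
    | ReflectF _ => 0
    end.
  have [p [pE _]] := cp _ e; exists p => k; rewrite -compA pE /e.
  case: (k =P i) => [E|_]; last by rewrite compm0.
  by case: _ / E => /=; rewrite compm1.
exists (fun i => projT1 (boolp.cid (pex i))).
have [u [uE uU]] := cp _ inj.
rewrite -(uU (idm X)); last by move=> i; rewrite comp1m.
apply/esym/uU => k; rewrite comp_suml (bigD1 k) //= big1 => [|i ik].
  by rewrite (projT2 (boolp.cid (pex k))) eqxx addr0.
by rewrite (projT2 (boolp.cid (pex i))) eq_sym (negPf ik).
Qed.

Lemma tge_coproduct (t : tStruct T) m n (F : 'I_n -> T) X
    (inj : forall i, mor (F i) X) :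
  is_coproduct inj -> (forall i, tge t m (F i)) -> tge t m X.
Proof.
move=> cp cF; have [p pE] := coproduct_resolution cp.
apply/tgeP => D f aD; rewrite -[f]comp1m -pE comp_suml big1 // => i _.
by have /tgeP/(_ _ (p i ∘ f) aD) e := cF i; rewrite -compA e compm0.
Qed.

End Sums.

(** * Factoring through bounded below objects *)

Section Factor.
Variables (T : triCat) (t : tStruct T).
Implicit Types (X Y Z D E : T) (S : T -> Prop).

Definition factors_through (S : T -> Prop) (m : int) X Y (f : mor X Y) :=
  exists (Q : T) (s : mor X Q) (w : mor Q Y),
    [/\ S Q, tge t m Q & w ∘ s = f].

(** A weak truncation property.  Objects of <G>_d need not have truncations in
    <G>_d, and retracts would not inherit them; a possibly non-unique
    factorization through <G>_d is inherited.  The uniformity in [m] makes the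
    property invariant under shifts. *)
Definition has_amplitude (S : T -> Prop) (b : nat) X :=
  forall (m : int) E (f : mor X E), tge t m E -> factors_through S (m - b%:Z) f.

Lemma factors_comp S m X Y Z (f : mor Y Z) (g : mor X Y) :
  factors_through S m f -> factors_through S m (f ∘ g).
Proof. by case=> Q [s [w [SQ cQ <-]]]; exists Q, (s ∘ g), w; rewrite compA. Qed.

Lemma factors_mono (S S' : T -> Prop) m m' X Y (f : mor X Y) :
  (forall Q, S Q -> S' Q) -> m' <= m ->
  factors_through S m f -> factors_through S' m' f.
Proof.
move=> SS mm [Q [s [w [SQ cQ <-]]]]; exists Q, s, w.
by split=> //; [apply: SS | apply: tge_mono cQ].
Qed.

Lemma add_closure_zob (S : T -> Prop) : add_closure S zob.
Proof.
apply: (@add_coprod _ _ 0 (fun=> zob) _ (fun=> 0)); last by case.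
move=> Y f; exists 0; split=> [[]//|u _].
by rewrite (proj2 (zobP _) u).
Qed.

Lemma factors_zero S m X Y : factors_through (add_closure S) m (0 : mor X Y).
Proof.
exists zob, 0, 0; split; [exact: add_closure_zob | exact: tge_zob |].
exact: comp0m.
Qed.

(** Use the direct sum of the two intermediate objects. *)
Lemma factorsD S m X Y (f g : mor X Y) :
  factors_through (add_closure S) m f -> factors_through (add_closure S) m g ->
  factors_through (add_closure S) m (f + g).
Proof.
move=> [Q [s [w [SQ cQ <-]]]] [Q' [s' [w' [SQ' cQ' <-]]]].
pose F (i : 'I_2) := if val i is 0%N then Q else Q'.
have [Z [inj cp]] := addcat_coprod F.
pose e (i : 'I_2) : mor (F i) Y :=
  match val i as k return mor (if k is 0%N then Q else Q') Y with
  | 0%N => w | _ => w' end.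
have [u [uE _]] := cp _ e.
have u0 : u ∘ (inj ord0 : mor Q Z) = w := uE ord0.
have u1 : u ∘ (inj ord_max : mor Q' Z) = w' := uE ord_max.
exists Z, ((inj ord0 : mor Q Z) ∘ s + (inj ord_max : mor Q' Z) ∘ s'), u; split.
- by apply: add_coprod cp _ => -[[|[|]] //= ?].
- by apply: tge_coproduct cp _ => -[[|[|]] //= ?].
- by rewrite compDr !compA u0 u1.
Qed.

Lemma amplitude_retract S b X Y :
  is_retract X Y -> has_amplitude S b Y -> has_amplitude S b X.
Proof.
case=> s [r rs] aY m E f cE; rewrite -[f]compm1 -rs compA.
exact/factors_comp/aY.
Qed.

Lemma isomorphic_retract X Y : isomorphic X Y -> is_retract Y X.
Proof. by case=> f [g [_ fg]]; exists g, f. Qed.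

Lemma amplitude_shift S b n X :
  has_amplitude (add_closure S) b X ->
  has_amplitude (add_closure S) b (shift T n X).
Proof.
move=> aX m E f cE; have [i [v [ii ->]]] := shift_map_to f.
have cE' : tge t (n + m) (shift T (- n) E) by apply/tge_shift; rewrite addKr.
have [Q [s [w [SQ cQ <-]]]] := aX _ _ v cE'.
exists (shift T n Q), (fmap (shift T n) s), (i ∘ fmap (shift T n) w).
split; first exact: add_shift.
  by apply/tge_shift; rewrite addrA.
by rewrite fmapM compA.
Qed.

(** For a coproduct, a map out of it is the sum of its restrictions composed
    with the projections, and sums of factorizable maps are factorizable. *)
Lemma amplitude_add_closure (S S' : T -> Prop) b :
  (forall X, S X -> has_amplitude (add_closure S') b X) ->
  forall X, add_closure S X -> has_amplitude (add_closure S') b X.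
Proof.
move=> aS X; elim=> {X}.
- exact: aS.
- move=> X Y _ aX XY; exact: amplitude_retract (isomorphic_retract XY) aX.
- move=> X n _; exact: amplitude_shift.
- move=> n F X inj cp _ aF m E f cE.
  have [p pE] := coproduct_resolution cp.
  rewrite -[f]compm1 -pE comp_sumr; apply: big_ind.
  + exact: factors_zero.
  + by move=> g h; apply: factorsD.
  + by move=> i _; rewrite compA; apply/factors_comp/aF.
- move=> X Y _ aY XY; exact: amplitude_retract XY aY.
Qed.

(** Let f : C -> E with E in T>=m, and C the cone of phi : A -> B.  The
    restriction of f to B factors through some QB.  Since A -> B -> C is zero,
    A -> QB lifts to the fiber of QB -> E, which is still bounded below, so this
    lift factors through some QA.  Passing through the fiber makes
    QA -> QB -> E zero, so QB -> E extends to the cone C' of QA -> QB.  The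
    composite C -> C' -> E agrees with f on B; the difference factors
    through A[1] and is handled by the hypothesis on A[1].  The successor in the
    bound comes from the shift of QA in the triangle QB -> C' -> QA[1]. *)
Lemma amplitude_cone (SA SB S : T -> Prop) a b A B C
    (phi : mor A B) (g : mor B C) (h : mor C (sus A)) :
  (forall X Y (psi : mor X Y) Z,
     SA X -> SB Y -> is_cone psi Z -> S Z) ->
  (forall X, SA X -> add_closure S X) ->
  dist phi g h ->
  has_amplitude SA a A -> has_amplitude SA a (sus A) -> has_amplitude SB b B ->
  has_amplitude (add_closure S) (b + a).+1 C.
Proof.
move=> coneS subS d aA asA aB m E f cE.
have [QB [sB [wB [SQB cQB wsB]]]] := aB _ _ (f ∘ g) cE.
have [Fo [i [j dF]]] := dist_fiber wB.
have cF : tge t (m - b%:Z) Fo.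
  by apply: tge_fiber dF cQB _; apply: tge_mono cE; lia.
have [l lE] : exists l, i ∘ l = sB ∘ phi.
  apply: (dist_lift dF).
  by rewrite compA wsB -compA (dist_comp0 d) compm0.
have [QA [sA [wA [SQA cQA wsA]]]] := aA _ _ l cF.
have [C' [g' [h' d']]] := dist_cone (i ∘ wA).
have [c [cg _]] : exists c, c ∘ g = g' ∘ sB /\ fmap sus sA ∘ h = h' ∘ c.
  by apply: dist_map d d' _; rewrite -compA wsA lE.
have [e eE] : exists e, e ∘ g' = wB.
  by apply: (dist_ext d'); rewrite compA (dist_comp0 dF) comp0m.
have [k kE] : exists k, k ∘ h = f - e ∘ c.
  apply: (dist_ext (proj1 (dist_rot _ _ _) d)).
  by rewrite compBl -compA cg compA eE wsB subrr.
rewrite -[f](subrK (e ∘ c)) -kE; apply: factorsD.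
  by apply/factors_comp/(factors_mono subS _ (asA _ _ k cE)); lia.
exists C', c, e; split=> //.
  by apply/add_gen/(coneS _ _ (i ∘ wA)) => //; exists g', h'.
apply: tge_cone d' _ _; first by apply: tge_mono cQB; lia.
by apply: tge_mono cQA; lia.
Qed.

Lemma cone_to_zob X : is_cone (0 : mor X zob) (sus X).
Proof.
by exists 0, (- fmap sus (idm X)); apply/(proj1 (dist_rot _ _ _))/dist_id.
Qed.

Definition cone_class (S : T -> Prop) d Z :=
  exists (A B : T) (phi : mor A B),
    [/\ gen_level S d A, add_closure S B & is_cone phi Z].

Lemma gen_levelSS S d : gen_level S d.+2 = add_closure (cone_class S d.+1).
Proof. by []. Qed.

(** Gives every level its closure under shifts and retracts without a case
    distinction on d. *)
Lemma gen_level_add S d :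
  exists S', gen_level S d.+1 = add_closure S'.
Proof. by case: d => [|d]; [exists S | exists (cone_class S d.+1)]. Qed.

(** X is the cone of X[-1] -> 0. *)
Lemma gen_levelS S d X : gen_level S d.+1 X -> gen_level S d.+2 X.
Proof.
move=> gX; rewrite gen_levelSS.
apply: add_iso (isomorphic_sym (sus_unsus X)).
apply: add_gen; exists (desus X), zob, 0; split.
- have [S' e] := gen_level_add S d; rewrite e in gX *.
  exact: (add_shift (-1) gX).
- exact: add_closure_zob.
- exact: cone_to_zob.
Qed.

Lemma gen_level_amplitude (tb : bounded t) G d :
  exists b, forall X, gen_level (fun Y => Y = G) d.+1 X ->
    has_amplitude (gen_level (fun Y => Y = G) d.+1) b X.
Proof.
(* If G lies in degrees [-n, n], then b = 2n works: for n < m all maps from G to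
   E vanish, and otherwise m - 2n <= -n. *)
have [b1 H1] : exists b, forall X, add_closure (fun Y => Y = G) X ->
    has_amplitude (add_closure (fun Y => Y = G)) b X.
  have [n [n0 aG cG]] := tb G.
  exists (`|n| + `|n|)%N; apply: amplitude_add_closure => _ -> m E f cE.
  have [nm|mn] := ltP n m.
    rewrite (_ : f = 0); first exact: factors_zero.
    by move/tgeP: cE; apply; apply: tle_mono aG; lia.
  exists G, (idm G), f; rewrite compm1; split=> //; first exact: add_gen.
  by apply: tge_mono cG; lia.
elim: d => [|d [b IH]]; first by exists b1.
exists (b1 + b).+1; rewrite gen_levelSS; apply: amplitude_add_closure => C.
case=> A [B [phi [gA gB [g [h dC]]]]].
apply: amplitude_cone dC (IH _ gA) (IH _ _) (H1 _ gB).
- by move=> X Y psi Z gX gY cZ; exists X, Y, psi.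
- by move=> X; apply: gen_levelS.
- have [S' e] := gen_level_add (fun Y => Y = G) d; rewrite e in gA *.
  exact: (add_shift 1 gA).
Qed.

End Factor.

Theorem proposition3p5 (T : triCat) (t : tStruct T) (tb : bounded t)
    (G : T) (d : nat) (d_gt0 : (0 < d)%N) (P : T -> Prop)
    (approxP : forall (E : T) (a : int),
       exists (X : T) (f : mor X E), P X /\ iso_in_degrees_ge t a f) :
  (forall E : T, gen_level (fun X : T => X = G) d E) <->
  (forall E : T, P E -> gen_level (fun X : T => X = G) d E).
Proof.
split=> [gen E _|genP E]; first exact: gen.
case: d d_gt0 genP => // d _ genP.
have [b amp] := gen_level_amplitude tb G d.
have [n [_ _ cE]] := tb E.
have [X [f [PX iH]]] := approxP E (- n - b%:Z).
have ef := iso_in_degrees_ge_equiv tb iH.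
have [Q [s [w [gQ cQ wsE]]]] := amp _ (genP _ PX) _ _ f cE.
have [v [vE _]] := ef _ cQ s.
have [S' e] := gen_level_add (fun Y => Y = G) d; rewrite e in gQ *.
apply: add_retract gQ _; exists v, w.
apply: (tge_equivP ef); first by apply: tge_mono cE; lia.
by rewrite -compA vE wsE comp1m.
Qed.
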